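(* Let $\mathcal{J}=\langle U,g,f\rangle$ be an optimal control problem satisfying the standing assumptions below, and let $(\theta^k)_{k\geq 1}$ be a sequence of evaluations satisfying the long-term condition (LTC). Then: (i) $V^*=\sup_{k\in \mathbb{N}}\inf_{t\in \mathbb{R}_+} V_{\mathcal{T}_t \sharp \theta^k}$ (pointwise on $\mathbb{R}^d$); (ii) any accumulation point, for the uniform convergence on $\mathbb{R}^d$, of the sequence $(V_{\theta^k})_{k}$ is equal to $V^*$; (iii) the sequence $(V_{\theta^k})_{k}$ converges uniformly on $\mathbb{R}^d$ if and only if the set $\{V_{\theta^k}: k\geq 1\}$ is totally bounded for the uniform norm $\|\cdot\|_\infty$.
   Context: Setting: $U$ is a metric space, $g:\mathbb{R}^d\times U\to\mathbb{R}$ is Borel measurable and bounded, $f:\mathbb{R}^d\times U\to\mathbb{R}^d$ is Borel measurable with $\|f(y,u)-f(\bar y,u)\|\leq L\|y-\bar y\|$ for some $L\geq0$ and all $y,\bar y,u$, and $\|f(y,u)\|\leq a(1+\|y\|)$ for some $a>0$ and all $y,u$. $\mathcal{U}$ is the set of measurable controls $u:[0,+\infty)\to U$; $y(t,u,y_0)$ denotes the unique absolutely continuous solution of $y'(t)=f(y(t),u(t))$, $y(0)=y_0$. An evaluation is a Borel probability measure $\theta\in\Delta(\mathbb{R}_+)$. For $\theta\in\Delta(\mathbb{R}_+)$, $V_\theta(y_0)=\inf_{u\in\mathcal{U}}\int_{[0,+\infty)} g(y(s,u,y_0),u(s))\,d\theta(s)$. For $t\geq0$, $\mathcal{T}_t\sharp\theta$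 is the push-forward of $\theta$ by $s\mapsto s+t$, so $V_{\mathcal{T}_t\sharp\theta}(y_0)=\inf_{u\in\mathcal{U}}\int_{[0,+\infty)} g(y(s+t,u,y_0),u(s+t))\,d\theta(s)$. Define $V^*(y_0)=\sup_{\theta\in\Delta(\mathbb{R}_+)}\inf_{t\in\mathbb{R}_+}V_{\mathcal{T}_t\sharp\theta}(y_0)$. For $s\geq 0$, the $s$-total variation is $TV_s(\theta)=\sup_{Q\in\mathcal{B}(\mathbb{R}_+)}|\theta(Q)-\theta(Q+s)|$, and $\overline{TV}_S(\theta)=\sup_{0\leq s\leq S}TV_s(\theta)$. A sequence $(\theta^k)_{k\ge1}$ satisfies the LTC if for every $S>0$, $\overline{TV}_S(\theta^k)\to0$ as $k\to\infty$. *)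

(* Defs.v *)
From HB Require Import structures.
From mathcomp Require Import all_boot all_order all_algebra.
From mathcomp Require Import all_classical all_reals all_analysis.
Set Implicit Arguments. Unset Strict Implicit. Unset Printing Implicit Defensive.
Import Order.TTheory GRing.Theory Num.Theory.
Import numFieldNormedType.Exports.
Local Open Scope classical_set_scope.
Local Open Scope ring_scope.

Definition Borel (T : topologicalType) : set (set T) := <<s open >>.

Definition borel_fun (X Y : topologicalType) (h : X -> Y) : Prop :=
  forall B : set Y, Borel B -> Borel (h @^-1` B).

Section Control.
Variables (R : realType) (d : nat) (U : metricType R).

(* A measurable control u : [0,+oo) -> U, represented by a function on R whose
   restriction to [0,+oo) is Borel measurable (values on (-oo,0) are irrelevant). *)
Definition is_control (u : R -> U) : Prop :=
  forall B : set U, Borel B -> Borel ([set t : R | 0 <= t] `&` u @^-1` B).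

Definition abs_cont (V : normedModType R) (a b : R) (h : R -> V) : Prop :=
  forall e : R, 0 < e -> exists2 del : R, 0 < del &
    forall (n : nat) (I : nat -> R * R),
      (forall i, (i < n)%N -> a <= (I i).1 /\ (I i).1 <= (I i).2 /\ (I i).2 <= b) ->
      (forall i j, (i < n)%N -> (j < n)%N -> i <> j ->
         (I i).2 <= (I j).1 \/ (I j).2 <= (I i).1) ->
      \sum_(i < n) ((I i).2 - (I i).1) < del ->
      \sum_(i < n) `|h (I i).2 - h (I i).1| < e.

Definition is_solution (f : 'rV[R]_d * U -> 'rV[R]_d) (u : R -> U)
    (y0 : 'rV[R]_d) (y : R -> 'rV[R]_d) : Prop :=
  [/\ y 0 = y0,
      (forall T : R, 0 < T -> abs_cont 0 T y) &
      {ae (@lebesgue_measure R), forall t : R, 0 < t ->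
          derivable y t 1 /\ 'D_1 y t = f (y t, u t)}].

(* V_{T_t # theta}(y0) = inf_u \int_{[0,+oo)} g(y(s+t,u,y0), u(s+t)) dtheta(s) *)
Definition Vshift (g : 'rV[R]_d * U -> R) (f : 'rV[R]_d * U -> 'rV[R]_d)
    (theta : probability R R) (t : R) (y0 : 'rV[R]_d) : R :=
  inf [set r : R | exists (u : R -> U) (y : R -> 'rV[R]_d),
         [/\ is_control u, is_solution f u y0 y &
             r = Rintegral theta [set s : R | 0 <= s]
                   (fun s => g (y (s + t), u (s + t)))]].

Definition Vtheta (g : 'rV[R]_d * U -> R) (f : 'rV[R]_d * U -> 'rV[R]_d)
    (theta : probability R R) (y0 : 'rV[R]_d) : R :=
  inf [set r : R | exists (u : R -> U) (y : R -> 'rV[R]_d),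
         [/\ is_control u, is_solution f u y0 y &
             r = Rintegral theta [set s : R | 0 <= s]
                   (fun s => g (y s, u s))]].

Definition evaluation (theta : probability R R) : Prop :=
  theta [set s : R | s < 0] = 0%E.

Definition Vstar (g : 'rV[R]_d * U -> R) (f : 'rV[R]_d * U -> 'rV[R]_d)
    (y0 : 'rV[R]_d) : R :=
  sup [set r : R | exists theta : probability R R, evaluation theta /\
         r = inf [set Vshift g f theta t y0 | t in [set t : R | 0 <= t]]].

End Control.

Section TV.
Variable R : realType.

Definition TV (s : R) (theta : probability R R) : R :=
  sup [set `| fine (theta Q) - fine (theta [set q + s | q in Q]) |
       | Q in [set Q : set R | measurable Q /\ Q `<=` [set x : R | 0 <= x]]].

Definition TVbar (S : R) (theta : probability R R) : R :=
  sup [set TV s theta | s in [set s : R | 0 <= s <= S]].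

Definition LTC (thetas : nat -> probability R R) : Prop :=
  forall S : R, 0 < S -> (fun k => TVbar S (thetas k)) @ \oo --> (0 : R).

End TV.

(* Main.v *)
Require Import Defs.
From HB Require Import structures.
From mathcomp Require Import all_boot all_order all_algebra.
From mathcomp Require Import all_classical all_reals all_analysis.
From mathcomp Require Import measurable_realfun ring lra.
Import Order.TTheory GRing.Theory Num.Theory.
Import numFieldNormedType.Exports.
Set Implicit Arguments. Unset Strict Implicit. Unset Printing Implicit Defensive.
Local Open Scope classical_set_scope.
Local Open Scope ring_scope.

(** Identify each pair (control, trajectory) from [y0] with its running payoff
    [s |-> g (y s, u s)].  Averaging a payoff first against a fixed evaluation
    [theta] and then against [theta^k] differs little, by (LTC), from averaging it
    against [theta^k] alone; by Fubini this gives, uniformly in the initial state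
    and in [t],
    [V_{T_t # theta^k} >= inf_s V_{T_s # theta} - o(1)], which is (i) and also
    [V* <= liminf V_{theta^k}].  Conversely, (LTC) and dynamic programming make any
    function that stays within [e] of infinitely many [V_{theta^k}] nearly
    nondecreasing along trajectories, so that it lies below [V* + 3 e].  Hence every
    such function is within [3 e] of [V*]; applied with arbitrary [e] this is (ii),
    and applied to the centers of a finite [e]-net it is (iii), with no need to
    extract subsequences.  An initial state without trajectories is harmless, since
    all infima over the empty set are then [0]. *)

(** * Integrals of bounded functions *)

Section BoundedIntegrals.
Context d (T : measurableType d) (R : realType).
Variable mu : probability T R.

Lemma bounded_integrable (h : T -> R) (M : R) :
  measurable_fun setT h -> (forall x, `|h x| <= M) ->
  mu.-integrable setT (EFin \o h).
Proof.
move=> mh hM; apply: (measurable_bounded_integrable measurableT) => //.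
  by move: (fin_num_measure mu setT measurableT); rewrite fin_numElt => /andP[].
exists M; split; first exact: num_real.
by move=> r Mr x _; exact: le_trans (hM x) (ltW Mr).
Qed.

Lemma Rintegral_probability_cst (c : R) : Rintegral mu setT (fun=> c) = c.
Proof. by rewrite Rintegral_cst//= probability_setT mulr1. Qed.

Lemma Rintegral_le_cst (h : T -> R) (M c : R) :
  measurable_fun setT h -> (forall x, `|h x| <= M) ->
  (forall x, h x <= c) -> Rintegral mu setT h <= c.
Proof.
move=> mh hM hc; rewrite -[leRHS]Rintegral_probability_cst.
apply: le_Rintegral => //; first exact: bounded_integrable hM.
exact: (@bounded_integrable _ `|c|).
Qed.

Lemma Rintegral_ge_cst (h : T -> R) (M c : R) :
  measurable_fun setT h -> (forall x, `|h x| <= M) ->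
  (forall x, c <= h x) -> c <= Rintegral mu setT h.
Proof.
move=> mh hM hc; rewrite -[leLHS]Rintegral_probability_cst.
apply: le_Rintegral => //; last exact: bounded_integrable hM.
exact: (@bounded_integrable _ `|c|).
Qed.

Lemma normr_Rintegral_le (h : T -> R) (M : R) :
  measurable_fun setT h -> (forall x, `|h x| <= M) ->
  `|Rintegral mu setT h| <= M.
Proof.
move=> mh hM; rewrite ler_norml; apply/andP; split.
  by apply: (Rintegral_ge_cst mh hM) => x; have := hM x; rewrite ler_norml => /andP[].
by apply: (Rintegral_le_cst mh hM) => x; have := hM x; rewrite ler_norml => /andP[].
Qed.

(** Counting the multiples of [c] up to [x] rounds [x] down to the grid of step [c]; the count
    starts at level [c], since level [0] is always reached. *)
Lemma staircase_approx (c x : R) (n : nat) : 0 < c -> 0 <= x <= c * n%:R ->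
  0 <= x - c * \sum_(i < n) (c * i.+1%:R <= x)%R%:R <= c.
Proof.
move=> c0; elim: n x => [|n IH] x.
  by rewrite big_ord0 mulr0 subr0 => /andP[-> /=] /le_trans; apply; exact: ltW.
move=> /andP[x0 xn]; rewrite big_ord_recr /=.
have [xcn|cnx] := leP x (c * n%:R).
  have -> : (c * n.+1%:R <= x) = false.
    apply/negbTE; rewrite -ltNge; apply: le_lt_trans xcn _.
    by rewrite ltr_pM2l// ltr_nat.
  by rewrite addr0; apply: IH; rewrite x0.
rewrite (eq_bigr (fun=> 1)); last first.
  move=> i _; rewrite (_ : _ <= x)//; apply: le_trans (ltW cnx).
  by rewrite ler_pM2l// ler_nat ltn_ord.
rewrite sumr_const card_ord.
move: xn; rewrite mulrDr -(natr1 n) mulrDr mulr1 => xn.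
case: (leP (c * n%:R + c) x) => h /=; rewrite ?mulr1 ?mulr0; lra.
Qed.

(** Discrete layer-cake formula: integrating [staircase_approx] turns each indicator into the
    measure of a level set. *)
Lemma Rintegral_staircase (h : T -> R) (c : R) (n : nat) :
  0 < c -> measurable_fun setT h -> (forall x, 0 <= h x <= c * n%:R) ->
  `|Rintegral mu setT h -
    c * \sum_(i < n) fine (mu [set x | c * i.+1%:R <= h x])| <= c.
Proof.
move=> c0 mh hn.
have mA r : measurable [set x | r <= h x].
  have := mh measurableT `[r, +oo[%classic (measurable_itv _).
  by rewrite setTI preimage_itvcy; congr measurable; apply/seteqP; split.
have mI r : measurable_fun setT (fun x => (r <= h x)%R%:R : R).
  have -> : (fun x => (r <= h x)%R%:R : R) = \1_[set x | r <= h x].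
    apply/funext => x; rewrite indicE; case: (boolP (r <= h x)) => h'.
      by rewrite mem_set.
    by rewrite memNset//; exact/negP.
  exact: measurable_indic.
have mS n' : measurable_fun setT
    (fun x => \sum_(i < n') (c * i.+1%:R <= h x)%R%:R : R).
  exact: measurable_sum.
have bS n' x : `|\sum_(i < n') (c * i.+1%:R <= h x)%R%:R : R| <= n'%:R.
  rewrite ger0_norm ?sumr_ge0//.
  have -> : n'%:R = \sum_(i < n') (1 : R) by rewrite sumr_const card_ord.
  by apply: ler_sum => i _; rewrite lern1 leq_b1.
have hM x : `|h x| <= c * n%:R.
  by have /andP[h0 hx] := hn x; rewrite ger0_norm.
have E n' : \sum_(i < n') fine (mu [set x | c * i.+1%:R <= h x]) =
    Rintegral mu setT (fun x => \sum_(i < n') (c * i.+1%:R <= h x)%R%:R).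
  elim: n' => [|n' IH].
    rewrite big_ord0 -[LHS]Rintegral_probability_cst.
    by apply: eq_Rintegral => x _; rewrite big_ord0.
  rewrite big_ord_recr IH /=.
  under [RHS]eq_Rintegral do rewrite big_ord_recr /=.
  rewrite RintegralD//; last 2 first.
  - exact: bounded_integrable (bS _).
  - by apply: (@bounded_integrable _ 1) => // x; rewrite normr_nat lern1 leq_b1.
  congr (_ + _).
  transitivity (Rintegral mu setT \1_[set x | c * n'.+1%:R <= h x]).
    by rewrite /Rintegral integral_indic// setIT.
  apply: eq_Rintegral => x _.
  case: (boolP (_ <= h x)) => h'; first by rewrite mem_set.
  by rewrite memNset//; exact/negP.
have mcS : measurable_fun setT
    (fun x => c * \sum_(i < n) (c * i.+1%:R <= h x)%R%:R : R).
  by apply: measurable_funM.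
have bcS x : `|c * \sum_(i < n) (c * i.+1%:R <= h x)%R%:R| <= c * n%:R.
  by rewrite normrM gtr0_norm// ler_pM2l.
rewrite E -RintegralZl//; last exact: bounded_integrable (bS _).
rewrite -RintegralB//; last 2 first.
- exact: bounded_integrable hM.
- exact: bounded_integrable bcS.
apply: normr_Rintegral_le; first exact: measurable_funB.
move=> x; have /andP[A0 Ac] := staircase_approx c0 (hn x).
by rewrite ger0_norm.
Qed.

(* The factor 2 M comes from integrating the level-set discrepancy over [-M, M]. *)
Lemma Rintegral_level_sets (h1 h2 : T -> R) (M delta : R) :
  0 < M -> measurable_fun setT h1 -> measurable_fun setT h2 ->
  (forall x, `|h1 x| <= M) -> (forall x, `|h2 x| <= M) ->
  (forall r, `|fine (mu [set x | r <= h1 x]) -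
               fine (mu [set x | r <= h2 x])| <= delta) ->
  `|Rintegral mu setT h1 - Rintegral mu setT h2| <= 2 * M * delta.
Proof.
move=> M0 mh1 mh2 h1M h2M hd.
(* Adding [M] moves the values into [[0, 2 * M]], where the staircase estimate applies. *)
have shiftE (h : T -> R) : measurable_fun setT h -> (forall x, `|h x| <= M) ->
    Rintegral mu setT (fun x => h x + M) = Rintegral mu setT h + M.
  move=> mh hM; rewrite RintegralD ?Rintegral_probability_cst//.
    exact: bounded_integrable hM.
  by apply: (@bounded_integrable _ `|M|).
apply/ler_addgt0Pl => e e0.
(* Two staircase errors [c = 2 * M / n.+1] must fit into [e]. *)
have [n ne] : exists n : nat, 4 * M / e < n.+1%:R.
  exists (Num.bound (4 * M / e)); apply: (@lt_trans _ _ (Num.bound (4 * M / e))%:R).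
    by apply: archi_boundP; rewrite divr_ge0 ?mulr_ge0// ltW.
  by rewrite ltr_nat.
pose c := 2 * M / n.+1%:R.
have c0 : 0 < c by rewrite divr_gt0// mulr_gt0.
have cn : c * n.+1%:R = 2 * M by rewrite /c mulfVK.
have ce : 2 * c <= e.
  move: ne; rewrite ltr_pdivrMr// => ne; rewrite /c mulrA ler_pdivrMr//; lra.
have stair (h : T -> R) : measurable_fun setT h -> (forall x, `|h x| <= M) ->
    `|Rintegral mu setT h + M -
      c * \sum_(i < n.+1) fine (mu [set x | c * i.+1%:R - M <= h x])| <= c.
  move=> mh hM; rewrite -shiftE//.
  have setE r : [set x | r - M <= h x] = [set x | r <= h x + M].
    by apply/seteqP; split=> x /=; rewrite lerBlDr.
  under eq_bigr do rewrite setE.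
  apply: Rintegral_staircase => //; first exact: measurable_funD.
  by move=> x; rewrite cn; have := hM x; rewrite ler_norml => /andP[? ?]; lra.
have := stair _ mh1 h1M; have := stair _ mh2 h2M.
set S2 := \sum_(i < _) _; set S1 := \sum_(i < _) _ => H2 H1.
(* Each of the [n.+1] levels contributes at most [c * delta], and [c * n.+1 = 2 * M]. *)
have S12 : `|c * S1 - c * S2| <= 2 * M * delta.
  rewrite -mulrBr normrM gtr0_norm// -cn -mulrA ler_pM2l// /S1 /S2 -sumrB.
  apply: le_trans (ler_norm_sum _ _ _) _.
  have -> : n.+1%:R * delta = \sum_(i < n.+1) delta.
    by rewrite sumr_const card_ord mulr_natl.
  by apply: ler_sum => i _; exact: hd.
move: H1 H2 S12; rewrite !ler_norml => /andP[? ?] /andP[? ?] /andP[? ?].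
apply/andP; split; lra.
Qed.

End BoundedIntegrals.

(** * Fubini's theorem for bounded functions *)

Section FubiniBounded.
Context d1 d2 (T1 : measurableType d1) (T2 : measurableType d2) (R : realType).
Variables (m1 : probability T1 R) (m2 : probability T2 R).
Variables (F : T1 * T2 -> R) (M : R).
Hypothesis mF : measurable_fun setT F.
Hypothesis FM : forall z, `|F z| <= M.

Let integrable_prod : (m1 \x m2)%E.-integrable setT (EFin \o F).
Proof. exact: bounded_integrable FM. Qed.

Lemma Rintegral_swap :
  Rintegral m1 setT (fun x => Rintegral m2 setT (fun y => F (x, y))) =
  Rintegral m2 setT (fun y => Rintegral m1 setT (fun x => F (x, y))).
Proof.
have H := Fubini integrable_prod.
rewrite /Rintegral.
transitivity (fine (\int[m1]_x \int[m2]_y (F (x, y))%:E)%E).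
  congr fine; apply: eq_integral => x _; rewrite fineK//.
  apply: integrable_fin_num => //; apply: (@bounded_integrable _ _ _ _ _ M) => //.
  exact: measurableT_comp.
rewrite H; congr fine; apply: eq_integral => y _; rewrite fineK//.
apply: integrable_fin_num => //; apply: (@bounded_integrable _ _ _ _ _ M) => //.
exact: measurableT_comp.
Qed.

Lemma measurable_Rintegral_r :
  measurable_fun setT (fun x => Rintegral m2 setT (fun y => F (x, y))).
Proof.
apply: measurableT_comp; first exact: fine_measurable.
exact: (measurable_fubini_F integrable_prod).
Qed.

End FubiniBounded.

(** * Evaluations and total variation *)

Section Evaluations.
Variable R : realType.
Implicit Types (theta : probability R R) (h k : R -> R).

Lemma measurable_ge0 : measurable [set s : R | 0 <= s].
Proof. by rewrite -set_itvcy; exact: measurable_itv. Qed.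

Lemma measurable_pos : measurable_fun setT (fun s : R => Num.max s 0).
Proof. exact: measurable_maxr. Qed.

(* Under an evaluation the negative half-line is null, so every integral over
   [0, +oo) can be taken over R after composing with the positive part. *)
Lemma Rintegral_pos theta k (M : R) : evaluation theta ->
  measurable_fun setT (fun s : R => k (Num.max s 0)) ->
  (forall s, 0 <= s -> `|k s| <= M) ->
  Rintegral theta [set s : R | 0 <= s] k =
  Rintegral theta setT (fun s : R => k (Num.max s 0)).
Proof.
move=> th0 mk kM; rewrite [RHS]/Rintegral (negligible_integral (N := [set s : R | s < 0]))//.
- rewrite (_ : _ `\` _ = [set s : R | 0 <= s]); last first.
    apply/seteqP; split => x /=; first by move=> [_ /negP]; rewrite -leNgt.
    by move=> x0; split => //; apply/negP; rewrite -leNgt.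
  congr fine; apply: eq_integral => x; rewrite inE /= => x0.
  by rewrite (max_idPl x0).
- by rewrite -set_itvNyo; exact: measurable_itv.
- apply: (@bounded_integrable _ _ _ _ _ M) => // x.
  by apply: kM; rewrite le_max lexx orbT.
Qed.

Local Notation p theta A := (fine (theta A)).

Lemma fine_prob_ge0 theta (A : set R) : 0 <= p theta A.
Proof. by rewrite fine_ge0. Qed.

Lemma fine_prob_le1 theta (A : set R) : measurable A -> p theta A <= 1.
Proof.
by move=> mA; rewrite -lee_fin fineK ?fin_num_measure//; exact: probability_le1.
Qed.

Lemma fine_probU theta (A B : set R) : measurable A -> measurable B ->
  A `&` B = set0 -> p theta (A `|` B) = p theta A + p theta B.
Proof. by move=> mA mB AB; rewrite measureU// fineD// fin_num_measure. Qed.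

Lemma fine_prob_le theta (A B : set R) : measurable A -> measurable B ->
  A `<=` B -> p theta A <= p theta B.
Proof.
by move=> mA mB AB; apply: fine_le; rewrite ?fin_num_measure// le_measure// inE.
Qed.

Lemma translate_preimage (Q : set R) (t : R) :
  [set q + t | q in Q] = (fun x => x - t) @^-1` Q.
Proof.
apply/seteqP; split => x /=; first by move=> [q Qq <-]; rewrite addrK.
by move=> Qx; exists (x - t) => //; rewrite subrK.
Qed.

Lemma measurable_translate (Q : set R) (t : R) :
  measurable Q -> measurable [set q + t | q in Q].
Proof.
move=> mQ; rewrite translate_preimage -[X in measurable X]setTI.
have : measurable_fun setT (fun x : R => x - t) by exact: measurable_funB.
exact.
Qed.

Lemma fine_prob_dist_le1 theta (A B : set R) : measurable A -> measurable B ->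
  `|p theta A - p theta B| <= 1.
Proof.
move=> mA mB; have := fine_prob_ge0 theta A; have := fine_prob_ge0 theta B.
have := fine_prob_le1 theta mA; have := fine_prob_le1 theta mB.
by rewrite ler_norml => *; apply/andP; split; lra.
Qed.

Lemma TV_ge theta (t : R) (Q : set R) : measurable Q ->
  Q `<=` [set x : R | 0 <= x] ->
  `|p theta Q - p theta [set q + t | q in Q]| <= TV t theta.
Proof.
move=> mQ Q0; apply: ub_le_sup; last by exists Q.
exists 1 => _ [B [mB _] <-].
by apply: fine_prob_dist_le1 => //; exact: measurable_translate.
Qed.

Lemma TV_le1 theta (t : R) : TV t theta <= 1.
Proof.
apply: ge_sup; first by eexists; exists set0; [split => //; exact: sub0set|reflexivity].
move=> _ [B [mB _] <-].
by apply: fine_prob_dist_le1 => //; exact: measurable_translate.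
Qed.

Lemma TV_le_TVbar theta (S t : R) : 0 <= t <= S -> TV t theta <= TVbar S theta.
Proof.
move=> tS; apply: ub_le_sup; last by exists t.
by exists 1 => _ [s _ <-]; exact: TV_le1.
Qed.

(** The two sets differ only in negative points, a null set for an evaluation. *)
Lemma fine_prob_ge0E theta (E : set R) : evaluation theta -> measurable E ->
  p theta ((fun s : R => Num.max s 0) @^-1` E) = p theta ([set s : R | 0 <= s] `&` E).
Proof.
move=> th0 mE; have mpre : measurable ((fun s : R => Num.max s 0) @^-1` E).
  by rewrite -[X in measurable X]setTI; exact: measurable_pos.
have mneg : measurable [set s : R | s < 0].
  by rewrite -set_itvNyo; exact: measurable_itv.
have mD := measurable_ge0.
set A := _ @^-1` E in mpre *.
have -> : A = ([set s : R | 0 <= s] `&` E) `|` (A `&` [set s : R | s < 0]).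
  apply/seteqP; split => x /=; rewrite /A /=.
    have [x0|x0] := leP 0 x; first by left.
    by right.
  by move=> [[x0]|[]//]; rewrite (max_idPl x0).
rewrite fine_probU//; last 3 first.
- exact: measurableI.
- exact: measurableI.
- by apply/seteqP; split => x //= -[[x0 _] [_]]; rewrite ltNge x0.
suff -> : p theta (A `&` [set s : R | s < 0]) = 0 by rewrite addr0.
apply/eqP; rewrite eq_le fine_prob_ge0 andbT.
have zE : p theta [set s : R | s < 0] = 0 by rewrite th0.
by rewrite -[leRHS]zE; apply: fine_prob_le => //; exact: measurableI.
Qed.

(** With [D] the half-line, each level set of [h] in [D] is the translate by [t] of the level set
    [Q] of the shifted function, plus a piece of [D] outside [D + t]. Both the move from [Q] to
    [Q + t] and the mass of that piece cost at most [TV t theta]; [Rintegral_level_sets] then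
    multiplies by [2 * M]. *)
Lemma Rintegral_shift_TV theta h (M t : R) : evaluation theta ->
  measurable_fun setT h -> 0 < M -> (forall s, `|h s| <= M) -> 0 <= t ->
  `|Rintegral theta setT (fun s : R => h (Num.max s 0)) -
    Rintegral theta setT (fun s : R => h (Num.max s 0 + t))| <= 4 * M * TV t theta.
Proof.
move=> th0 mh M0 hM t0.
have mht : measurable_fun setT (fun s : R => h (s + t)).
  by apply: (measurableT_comp mh); exact: measurable_funD.
have mpos := measurable_pos.
have mD := measurable_ge0.
rewrite (_ : 4 * M * _ = 2 * M * (2 * TV t theta)); last by ring.
apply: Rintegral_level_sets => //.
- exact: measurableT_comp mh _.
- exact: measurableT_comp mht _.
move=> r.
have mlev k : measurable_fun setT k -> measurable [set s | r <= k s].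
  move=> mk; have := mk measurableT `[r, +oo[%classic (measurable_itv _).
  by rewrite setTI preimage_itvcy; congr measurable; apply/seteqP; split.
have -> := fine_prob_ge0E th0 (mlev _ mh).
have -> := fine_prob_ge0E th0 (mlev _ mht).
set D := [set s : R | 0 <= s] in mD *.
set E := [set s | r <= h s]; set Q := D `&` [set s | r <= h (s + t)].
have mE : measurable E by exact: mlev.
have mQ : measurable Q by apply: measurableI => //; exact: mlev.
have mQt := measurable_translate t mQ.
have mDt := measurable_translate t mD.
have TVQ : `|p theta Q - p theta [set q + t | q in Q]| <= TV t theta.
  by apply: TV_ge => // x [].
have TVD : `|p theta D - p theta [set q + t | q in D]| <= TV t theta.
  exact: TV_ge.
have mI : measurable (D `\` [set q + t | q in D]) by exact: measurableD.
have DtD : [set q + t | q in D] `<=` D by move=> _ [q q0 <-]; rewrite /D /= addr_ge0.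
have QtE : [set q + t | q in Q] `<=` D `&` E.
  by move=> _ [q [q0 rq] <-]; split => //; apply: DtD; exists q.
have mDE : measurable (D `&` E) by exact: measurableI.
have DE : p theta D = p theta [set q + t | q in D] +
                      p theta (D `\` [set q + t | q in D]).
  by rewrite -fine_probU//; [rewrite setDUK|rewrite setDIK].
have mDE' : measurable ((D `&` E) `\` [set q + t | q in Q]).
  exact: measurableD.
have DEE : p theta (D `&` E) = p theta [set q + t | q in Q] +
                      p theta ((D `&` E) `\` [set q + t | q in Q]).
  by rewrite -fine_probU//; [rewrite setDUK|rewrite setDIK].
(* A point of [D + t] in the level set is already a translate from [Q], so the leftover avoids
   [D + t]. *)
have : p theta ((D `&` E) `\` [set q + t | q in Q]) <=
       p theta (D `\` [set q + t | q in D]).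
  apply: fine_prob_le => // x [[x0 Ex] nQ]; split => //.
  move=> [q q0 qx]; apply: nQ; exists q => //; split => //=.
  by move: Ex; rewrite -qx.
have := fine_prob_ge0 theta ((D `&` E) `\` [set q + t | q in Q]).
move: TVQ TVD; rewrite !ler_norml => /andP[? ?] /andP[? ?] ? ?.
apply/andP; split; lra.
Qed.

End Evaluations.

(** * Averaging one evaluation against another *)

Section Comparison.
Variable R : realType.
Implicit Types (theta : probability R R) (h : R -> R).
Local Notation pos := (fun s : R => Num.max s 0).

Lemma pos_ge0 (s : R) : 0 <= pos s.
Proof. by rewrite le_max lexx orbT. Qed.

(** Continuity from above along the decreasing sets []n, +oo[], whose intersection is empty. *)
Lemma evaluation_tail theta (e : R) : 0 < e ->
  exists2 S : R, 0 < S & fine (theta `]S, +oo[%classic) <= e.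
Proof.
move=> e0.
pose F (n : nat) := `]n%:R, +oo[%classic : set R.
have mF n : measurable (F n) by exact: measurable_itv.
have F0 : \bigcap_n F n = set0.
  apply/seteqP; split => // x /(_ (Num.bound `|x|) I).
  rewrite /F /= in_itv/= andbT => xb.
  have := archi_boundP (normr_ge0 x); have := ler_norm x; lra.
have : (theta \o F) @ \oo --> theta (\bigcap_n F n).
  apply: nonincreasing_cvg_mu => //.
  - by rewrite ltey_eq fin_num_measure.
  - by rewrite F0.
  - move=> n m nm; apply/subsetPset => x; rewrite /F /= !in_itv/= !andbT.
    by apply: le_lt_trans; rewrite ler_nat.
rewrite F0 measure0 => /fine_cvgP[_ /cvgrPdist_le /(_ e e0)[N _ HN]].
(* [N.+1] rather than [N] makes the cut-off positive. *)
exists N.+1%:R => //.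
have := HN N.+1 (leqnSn N); rewrite /= sub0r normrN ger0_norm//.
exact: fine_ge0.
Qed.

(* Averaging [t |-> \int h (s + t) dtheta'(s)] against [theta]: by near invariance
   of [theta'] the average is close to [\int h dtheta'], and by Fubini it is a
   [theta']-average of integrals against shifts of [theta]. *)
Lemma Rintegral_ge_of_shifts theta theta' h (M S delta e c : R) :
  measurable_fun setT h -> (forall s, `|h s| <= M) ->
  (forall t, 0 <= t <= S ->
    `|Rintegral theta' setT (fun s : R => h (pos s)) -
      Rintegral theta' setT (fun s : R => h (pos s + t))| <= delta) ->
  0 <= S -> fine (theta `]S, +oo[%classic) <= e ->
  (forall t, 0 <= t -> c <= Rintegral theta setT (fun s : R => h (pos s + t))) ->
  c <= Rintegral theta' setT (fun s : R => h (pos s)) + delta + 2 * M * e.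
Proof.
move=> mh hM hdelta S0 Se hc.
have mpos := @measurable_pos R.
have M0 : 0 <= M by apply: le_trans (hM 0).
pose F (z : R * R) := h (pos z.1 + pos z.2).
have mF : measurable_fun setT F.
  apply: (measurableT_comp mh); apply: measurable_funD.
    exact: measurableT_comp mpos measurable_fst.
  exact: measurableT_comp mpos measurable_snd.
have FM z : `|F z| <= M by exact: hM.
set I0 := Rintegral theta' setT _.
pose A (t : R) := Rintegral theta' setT (fun s : R => F (t, s)).
have mA : measurable_fun setT A.
  exact: (@measurable_Rintegral_r _ _ _ _ _ theta theta' _ M mF FM).
have F1 t : measurable_fun setT (fun s : R => F (t, s)).
  by apply: (measurableT_comp mF).
have F2 t : measurable_fun setT (fun s : R => F (s, t)).
  by apply: (measurableT_comp mF).
have AM t : `|A t| <= M by apply: normr_Rintegral_le.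
have I0M : `|I0| <= M.
  by apply: normr_Rintegral_le => //; exact: (measurableT_comp mh).
(* After the swap, the inner integral is one of the shifted [theta]-integrals bounded below by
   [c]. *)
have step1 : c <= Rintegral theta setT A.
  rewrite (Rintegral_swap theta theta' mF FM).
  apply: (@Rintegral_ge_cst _ _ _ _ _ M).
  - have mF' : measurable_fun setT (fun z : R * R => F (z.2, z.1)).
      apply: (measurableT_comp mF).
      exact: (measurable_fun_pair measurable_snd measurable_fst).
    exact: (@measurable_Rintegral_r _ _ _ _ _ theta' theta _ M mF').
  - by move=> t; apply: normr_Rintegral_le.
  - by move=> t; apply: le_trans (hc _ (pos_ge0 t)) _.
apply: (le_trans step1).
(* Up to [S], near invariance bounds [A] by [I0 + delta]; beyond [S], the crude bound
   [A - I0 <= 2 * M] is paid only on the tail mass. *)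
pose B (t : R) := I0 + delta + 2 * M * \1_(`]S, +oo[%classic) t.
have mind : measurable_fun setT (\1_(`]S, +oo[%classic) : R -> R).
  exact: measurable_indic.
have ind1 (t : R) : `|\1_(`]S, +oo[%classic) t : R| <= 1.
  by rewrite indicE; case: (_ \in _); rewrite ?normr0 ?normr1.
have d0 : 0 <= delta.
  by apply: le_trans (hdelta 0 _) => //; rewrite lexx.
have AB t : A t <= B t.
  rewrite /B; have [tS|St] := leP t S.
    have -> : A t = Rintegral theta' setT (fun s : R => h (pos s + pos t)).
      by apply: eq_Rintegral => s _; rewrite /F /= addrC.
    have : 0 <= pos t <= S by rewrite pos_ge0 ge_max tS.
    move=> /hdelta; rewrite ler_norml => /andP[H _].
    rewrite indicE memNset ?mulr0; first by move: H; rewrite /I0; lra.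
    by rewrite /= in_itv/= andbT; apply/negP; rewrite -leNgt.
  rewrite indicE mem_set; last by rewrite /= in_itv/= andbT.
  move: (AM t) I0M; rewrite !ler_norml => /andP[? ?] /andP[? ?].
  by rewrite mulr1; lra.
have intind : theta.-integrable setT (EFin \o (\1_(`]S, +oo[%classic) : R -> R)).
  exact: (@bounded_integrable _ _ _ _ _ 1).
have m2 : measurable_fun setT (fun t : R => 2 * M * \1_(`]S, +oo[%classic) t : R).
  exact: measurable_funM.
have b2 (t : R) : `|2 * M * \1_(`]S, +oo[%classic) t| <= 2 * M.
  by rewrite normrM ger0_norm ?mulr_ge0// ler_piMr ?mulr_ge0.
have -> : I0 + delta + 2 * M * e =
    Rintegral theta setT B + 2 * M * (e - fine (theta `]S, +oo[%classic)).
  rewrite /B RintegralD//; last 2 first.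
  - exact: (@bounded_integrable _ _ _ _ _ `|I0 + delta|).
  - exact: (@bounded_integrable _ _ _ _ _ (2 * M)).
  rewrite Rintegral_probability_cst RintegralZl//.
  have -> : Rintegral theta setT \1_(`]S, +oo[%classic) =
      fine (theta `]S, +oo[%classic) by rewrite /Rintegral integral_indic// setIT.
  by ring.
rewrite -[leLHS]addr0 lerD//; last by rewrite !mulr_ge0// subr_ge0.
apply: le_Rintegral => //; [exact: bounded_integrable AM| |by move=> t _; exact: AB].
apply: (@bounded_integrable _ _ _ _ _ (`|I0 + delta| + 2 * M)).
  exact: measurable_funD.
by move=> t; apply: le_trans (ler_normD _ _) _; rewrite lerD.
Qed.

End Comparison.

(** * Values of families of payoff streams *)

Section Streams.
Variables (R : realType) (Y : Type) (G : Y -> set (R -> R)) (M : R).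
Implicit Types (theta : probability R R) (h : R -> R) (t : R) (y z : Y).
Local Notation pos := (fun s : R => Num.max s 0).

(** The positive part sends negative times to [0]; for an evaluation this is the integral over the
    half-line. *)
Definition stream_payoff theta t h : R :=
  Rintegral theta setT (fun s : R => h (pos s + t)).

(** Abstract form of the value of the shifted evaluation, with [G y] in place of control-trajectory
    pairs; [stream_low] and [stream_sup] likewise mirror the infimum over shifts and $V^*$. *)
Definition stream_val theta t y : R := inf [set stream_payoff theta t h | h in G y].

Definition stream_low theta y : R :=
  inf [set stream_val theta t y | t in [set t : R | 0 <= t]].

Definition stream_sup y : R :=
  sup [set r | exists theta, evaluation theta /\ r = stream_low theta y].

Hypothesis M_gt0 : 0 < M.
Hypothesis G_measurable : forall y h, G y h -> measurable_fun setT h.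
Hypothesis G_bounded : forall y h, G y h -> forall s, `|h s| <= M.

Lemma measurable_shift_pos h t :
  measurable_fun setT h -> measurable_fun setT (fun s : R => h (pos s + t)).
Proof.
move=> mh; apply: (measurableT_comp mh).
by apply: measurable_funD => //; exact: measurable_pos.
Qed.

Lemma stream_payoff_le theta t y h : G y h -> `|stream_payoff theta t h| <= M.
Proof.
move=> Gh; apply: normr_Rintegral_le => [|s]; last exact: G_bounded Gh _.
exact: measurable_shift_pos (G_measurable Gh).
Qed.

Lemma stream_val_le theta t y h : G y h -> stream_val theta t y <= stream_payoff theta t h.
Proof.
move=> Gh; apply: ge_inf; last by exists h.
exists (- M) => _ [k Gk <-].
by have := stream_payoff_le theta t Gk; rewrite ler_norml => /andP[].
Qed.

Lemma stream_val_ge theta t y (c : R) : G y !=set0 ->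
  (forall h, G y h -> c <= stream_payoff theta t h) -> c <= stream_val theta t y.
Proof.
move=> [h Gh] hc; apply: lb_le_inf; first by exists (stream_payoff theta t h), h.
by move=> _ [k Gk <-]; exact: hc.
Qed.

Lemma stream_val0 theta t y : ~ (G y !=set0) -> stream_val theta t y = 0.
Proof.
move=> G0; rewrite /stream_val (_ : [set _ | _ in _] = set0) ?inf0//.
by rewrite -subset0 => r [h Gh _]; apply: G0; exists h.
Qed.

Lemma stream_val_bounded theta t y : `|stream_val theta t y| <= M.
Proof.
have [[h Gh]|G0] := pselect (G y !=set0); last by rewrite stream_val0// normr0 ltW.
rewrite ler_norml; apply/andP; split.
  apply: stream_val_ge; first by exists h.
  by move=> k /(stream_payoff_le theta t); rewrite ler_norml => /andP[].
apply: le_trans (stream_val_le _ _ Gh) _.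
by have := stream_payoff_le theta t Gh; rewrite ler_norml => /andP[].
Qed.

Lemma stream_low_le theta t y : 0 <= t -> stream_low theta y <= stream_val theta t y.
Proof.
move=> t0; apply: ge_inf; last by exists t.
exists (- M) => _ [s _ <-].
by have := stream_val_bounded theta s y; rewrite ler_norml => /andP[].
Qed.

Lemma stream_low_ge theta y (c : R) :
  (forall t, 0 <= t -> c <= stream_val theta t y) -> c <= stream_low theta y.
Proof.
move=> hc; apply: lb_le_inf.
  by exists (stream_val theta 0 y); exists 0 => //=; exact: lexx.
by move=> _ [t t0 <-]; exact: hc.
Qed.

Lemma stream_low0 theta y : ~ (G y !=set0) -> stream_low theta y = 0.
Proof.
move=> G0; apply/eqP; rewrite eq_le; apply/andP; split.
  by rewrite -[leRHS](stream_val0 theta 0 G0) stream_low_le.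
by apply: stream_low_ge => t _; rewrite stream_val0.
Qed.

Lemma stream_low_leM theta y : stream_low theta y <= M.
Proof.
apply: le_trans (stream_low_le theta y (lexx 0)) _.
by have := stream_val_bounded theta 0 y; rewrite ler_norml => /andP[].
Qed.

Lemma stream_sup_ge theta y : evaluation theta -> stream_low theta y <= stream_sup y.
Proof.
move=> th0; apply: ub_le_sup; last by exists theta.
by exists M => _ [k [_ ->]]; exact: stream_low_leM.
Qed.

(** The given evaluation makes the set nonempty: over the empty set [sup] would be [0] and could
    exceed [c]. *)
Lemma stream_sup_le theta y (c : R) : evaluation theta ->
  (forall theta', evaluation theta' -> stream_low theta' y <= c) -> stream_sup y <= c.
Proof.
move=> th0 hc; apply: ge_sup; first by exists (stream_low theta y), theta.
by move=> _ [k [k0 ->]]; exact: hc.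
Qed.

Lemma stream_payoff_shift theta t y h : G y h -> evaluation theta -> 0 <= t ->
  `|stream_payoff theta 0 h - stream_payoff theta t h| <= 4 * M * TV t theta.
Proof.
move=> Gh th0 t0.
rewrite (_ : stream_payoff theta 0 h = Rintegral theta setT (fun s : R => h (pos s))).
  exact: (Rintegral_shift_TV th0 (G_measurable Gh) M_gt0 (G_bounded Gh) t0).
by apply: eq_Rintegral => s _; rewrite addr0.
Qed.

Variable thetas : nat -> probability R R.
Hypothesis thetas_ev : forall k, evaluation (thetas k).
Hypothesis thetas_LTC : LTC thetas.

Lemma LTC_TVbar (S e : R) : 0 < S -> 0 < e ->
  exists N : nat, forall k, (N <= k)%N -> forall t, 0 <= t <= S -> TV t (thetas k) <= e.
Proof.
move=> S0 e0; have /cvgrPdist_le /(_ e e0)[N _ HN] := thetas_LTC S0.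
exists N => k Nk t tS; apply: le_trans (TV_le_TVbar _ tS) _.
by have := HN k Nk; rewrite /= sub0r normrN; apply: le_trans; exact: ler_norm.
Qed.

(** The averaging comparison is applied to the stream advanced by [t]. The cut-off [S] depends only
    on [theta] and [e], and the index only on [S] and [e], hence uniformity in [t] and [y]. *)
Lemma stream_low_le_val_LTC theta (e : R) : evaluation theta -> 0 < e ->
  exists N : nat, forall k, (N <= k)%N -> forall t y, 0 <= t ->
    stream_low theta y - e <= stream_val (thetas k) t y.
Proof.
move=> th0 e0.
(* The errors, [4 * M] and [2 * M] times this amount, add up to [3 * e / 4]. *)
have d0 : 0 < e / (8 * M) by rewrite divr_gt0// mulr_gt0.
have [S S0 tailS] := evaluation_tail theta d0.
have [N HN] := LTC_TVbar S0 d0.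
exists N => k Nk t y t0.
have [Gy|Gy] := pselect (G y !=set0); last first.
  by rewrite stream_low0// stream_val0// sub0r oppr_le0 ltW.
apply: stream_val_ge => // h Gh.
pose hT s := h (s + t).
have mhT : measurable_fun setT hT.
  by apply: (measurableT_comp (G_measurable Gh)); exact: measurable_funD.
have hTM s : `|hT s| <= M by exact: G_bounded Gh _.
have H : stream_low theta y <= Rintegral (thetas k) setT (fun s : R => hT (pos s)) +
    4 * M * (e / (8 * M)) + 2 * M * (e / (8 * M)).
  apply: (Rintegral_ge_of_shifts mhT hTM _ (ltW S0) tailS).
  - move=> s s0S.
    have s0 : 0 <= s by case/andP: s0S.
    apply: le_trans (Rintegral_shift_TV (thetas_ev k) mhT M_gt0 hTM s0) _.
    by rewrite ler_pM2l ?mulr_gt0//; exact: HN.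
  (* Shifting [hT] by [s] is shifting [h] by [s + t], one of the times in the infimum
     [stream_low]. *)
  - move=> s s0; apply: le_trans (stream_low_le theta y (addr_ge0 s0 t0)) _.
    apply: le_trans (stream_val_le _ _ Gh) _.
    by rewrite /stream_payoff /hT; under eq_Rintegral do rewrite addrA.
rewrite lerBlDr; apply: le_trans H _; rewrite -addrA lerD2l.
have -> : 4 * M * (e / (8 * M)) = e / 2 by field; rewrite gt_eqF.
have -> : 2 * M * (e / (8 * M)) = e / 4 by field; rewrite gt_eqF.
by move: e0; lra.
Qed.

(** For one inequality a single late index suffices for each [e]; the other holds since each
    [thetas k] is an evaluation. *)
Lemma stream_sup_LTC y :
  stream_sup y = sup [set stream_low (thetas k) y | k in [set: nat]].
Proof.
apply/eqP; rewrite eq_le; apply/andP; split.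
  apply: (stream_sup_le (thetas_ev 0)) => theta th0.
  apply/ler_addgt0Pl => e e0.
  have [N HN] := stream_low_le_val_LTC th0 e0.
  apply: (@le_trans _ _ (e + stream_low (thetas N) y)).
    by rewrite -lerBlDl; apply: stream_low_ge => t t0; exact: HN.
  rewrite lerD2l; apply: ub_le_sup; last by exists N.
  by exists M => _ [k _ <-]; exact: stream_low_leM.
apply: ge_sup; first by exists (stream_low (thetas 0) y), 0%N.
by move=> _ [k _ <-]; exact: stream_sup_ge.
Qed.

(* Dynamic programming: shifting an admissible stream gives a stream of some
   reachable state, and any stream of that state can be grafted at time [t]. *)
Hypothesis G_dynamic : forall y h t, G y h -> 0 <= t -> exists z,
  (exists2 h', G z h' & forall s, 0 <= s -> h' s = h (s + t)) /\
  (forall h', G z h' -> exists2 h'', G y h'' & forall s, 0 <= s -> h'' (s + t) = h' s).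

(* A function which stays within [e] of infinitely many values is nearly
   nondecreasing along trajectories, which bounds it from above by [V*]. *)
Lemma stream_sup_near (W : Y -> R) (e : R) :
  (forall N : nat, exists2 k, (N <= k)%N &
     forall y, `|stream_val (thetas k) 0 y - W y| <= e) ->
  forall y, `|W y - stream_sup y| <= 3 * e.
Proof.
move=> HW y.
have e0 : 0 <= e by have [k _ /(_ y)] := HW 0%N; exact: le_trans.
have Wup : stream_sup y <= W y + e.
  apply: (stream_sup_le (thetas_ev 0)) => theta th0.
  apply/ler_addgt0Pl => d d0.
  have [N HN] := stream_low_le_val_LTC th0 d0.
  have [k Nk /(_ y)] := HW N.
  have := HN k Nk 0 y (lexx 0); rewrite ler_norml => + /andP[].
  lra.
have Wlow : W y - 3 * e <= stream_sup y.
  (* Without streams all values at [y] are [0], so [W y <= e] and [stream_sup y = 0]. *)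
  have [Gy|Gy] := pselect (G y !=set0); last first.
    have [k _ /(_ y)] := HW 0%N; rewrite stream_val0// sub0r normrN.
    rewrite (_ : stream_sup y = 0); first by move=> /(le_trans (ler_norm _)); move: e0; lra.
    rewrite stream_sup_LTC; apply/eqP; rewrite eq_le; apply/andP; split.
      apply: ge_sup; first by exists (stream_low (thetas 0) y), 0%N.
      by move=> _ [j _ <-]; rewrite stream_low0.
    rewrite -[leLHS](stream_low0 (thetas 0) Gy); apply: ub_le_sup; last by exists 0%N.
    by exists M => _ [j _ <-]; exact: stream_low_leM.
  (* The index [k] is now fixed: the shifted values of this single evaluation bound [stream_sup]
     from below. *)
  have [k _ Hk] := HW 0%N.
  apply: le_trans (stream_sup_ge y (thetas_ev k)).
  apply: stream_low_ge => t t0; apply: stream_val_ge => // h Gh.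
  have [z [[h' Gh' h'E] zgraft]] := G_dynamic Gh t0.
  (* Grafting makes any stream of [z] the tail of a stream of [y], and a late evaluation barely sees
     the delay [t]. Replacing values by [W] costs [e] at each of [y] and [z]. *)
  have WzWy : W y - 2 * e <= W z.
    apply/ler_addgt0Pl => d d0.
    (* The condition [LTC] wants a positive horizon, while [t] may be [0]. *)
    have t1 : 0 < t + 1 by rewrite ltr_wpDl.
    have d1 : 0 < d / (4 * M) by rewrite divr_gt0// mulr_gt0.
    have [N HN] := LTC_TVbar t1 d1.
    have [j Nj Hj] := HW N.
    have := Hj y; have := Hj z; rewrite !ler_norml => /andP[? ?] /andP[? ?].
    suff : stream_val (thetas j) 0 y - d <= stream_val (thetas j) 0 z by lra.
    apply: stream_val_ge; first by exists h'.
    move=> k' /zgraft[k'' Gk'' k''E].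
    have -> : stream_payoff (thetas j) 0 k' = stream_payoff (thetas j) t k''.
      by apply: eq_Rintegral => s _; rewrite addr0 k''E// pos_ge0.
    have := stream_payoff_shift Gk'' (thetas_ev j) t0.
    have := stream_val_le (thetas j) 0 Gk''.
    have : 4 * M * TV t (thetas j) <= d.
      rewrite mulrC -ler_pdivlMr ?mulr_gt0//; apply: HN => //.
      by rewrite t0 /= lerDl ler01.
    rewrite ler_norml => ? ? /andP[? ?]; lra.
  (* The third [e] is lost in passing from [W z] back to the value at [z] for the index [k]. *)
  have -> : stream_payoff (thetas k) t h = stream_payoff (thetas k) 0 h'.
    by apply: eq_Rintegral => s _; rewrite addr0 h'E// pos_ge0.
  apply: le_trans (stream_val_le (thetas k) 0 Gh').
  by have := Hk z; rewrite ler_norml => /andP[]; lra.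
rewrite ler_norml; apply/andP; split; lra.
Qed.

Lemma stream_val_accumulation (W : Y -> R) :
  (forall e : R, 0 < e -> forall N : nat, exists2 k, (N <= k)%N &
     forall y, `|stream_val (thetas k) 0 y - W y| <= e) ->
  W = stream_sup.
Proof.
move=> HW; apply/funext => y; apply/eqP; rewrite -subr_eq0 -normr_le0.
apply/ler_addgt0Pl => e e0; rewrite addr0.
have e3 : 0 < e / 3 by rewrite divr_gt0.
have := stream_sup_near (HW _ e3) y; rewrite mulrC divfK//.
Qed.

(** The centers [f i] need not be values themselves; demanding it would at most double the
    radius. *)
Lemma stream_val_cvg_iff :
  (exists W : Y -> R, forall e : R, 0 < e -> exists N : nat,
     forall k, (N <= k)%N -> forall y, `|stream_val (thetas k) 0 y - W y| <= e) <->
  (forall e : R, 0 < e -> exists (n : nat) (f : nat -> Y -> R),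
     forall k, exists2 i : nat, (i < n)%N &
       forall y, `|stream_val (thetas k) 0 y - f i y| <= e).
Proof.
split=> [[W HW] e e0|Htb].
  have [N HN] := HW e e0.
  (* The net consists of the values before [N], followed by the limit as center number [N]. *)
  exists N.+1, (fun i => if (i < N)%N then stream_val (thetas i) 0 else W) => k.
  have [kN|Nk] := ltnP k N.
    by exists k; [exact: ltnW|move=> y; rewrite kN subrr normr0 ltW].
  by exists N => // y; rewrite ltnn; exact: HN.
exists stream_sup => e e0.
(* A center visited infinitely often is within [3 * (e / 4)] of [stream_sup], leaving [e / 4] for
   the net radius. *)
have e4 : 0 < e / 4 by rewrite divr_gt0.
have [n [f Hf]] := Htb _ e4.
pose near_f i k := forall y, `|stream_val (thetas k) 0 y - f i y| <= e / 4.
(* Past some index only the balls visited infinitely often are hit. *)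
have [N HN] : exists N, forall i, (i < n)%N -> forall k, (N <= k)%N -> near_f i k ->
    forall K : nat, exists2 k', (K <= k')%N & near_f i k'.
  elim: n {Hf} => [|n [N HN]]; first by exists 0%N.
  have [inf_n|fin_n] := pselect (forall K : nat, exists2 k', (K <= k')%N & near_f n k').
    by exists N => i; rewrite ltnS leq_eqVlt => /predU1P[->//|]; exact: HN.
  have [K HK] : exists K : nat, forall k', (K <= k')%N -> ~ near_f n k'.
    apply: contrapT => /forallNP nK; apply: fin_n => K.
    by have /existsNP[k' /not_implyP[Kk' /contrapT nk']] := nK K; exists k'.
  exists (maxn N K) => i; rewrite ltnS leq_eqVlt => /predU1P[->|ilt] k.
    by rewrite geq_max => /andP[_ /HK].
  by rewrite geq_max => /andP[Nk _]; exact: HN.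
exists N => k Nk y; have [i ilt ki] := Hf k.
have := stream_sup_near (HN i ilt k Nk ki) y; have := ki y.
rewrite !ler_norml => /andP[? ?] /andP[? ?]; apply/andP; split; lra.
Qed.

End Streams.

(** * Controlled trajectories *)

Section LebesgueTranslation.
Variable R : realType.
Local Notation mu := (@lebesgue_measure R).

(** The push-forward by a translation agrees with Lebesgue measure on half-open intervals, and these
    determine it. *)
Lemma lebesgue_measure_preimage_shift (t : R) (A : set R) : measurable A ->
  mu ((fun x => x + t) @^-1` A) = mu A.
Proof.
move=> mA.
have mS : measurable_fun setT ((fun x => x + t) : R -> measurableTypeR R).
  exact: measurable_funD.
transitivity (pushforward mu ((fun x => x + t) : R -> measurableTypeR R) A) => //.
apply/esym/lebesgue_measure_unique => //= _ [[a b]] _ <-.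
rewrite /pushforward (_ : _ @^-1` _ = `]a - t, b - t]%classic); last first.
  by apply/seteqP; split => x /=; rewrite !in_itv/= ltrBlDr lerBrDr.
by rewrite !lebesgue_measure_itv/= !lte_fin ltrD2r -!EFinB opprB addrA subrK.
Qed.

Lemma negligible_preimage_shift (t : R) (N : set R) : mu.-negligible N ->
  mu.-negligible ((fun x => x + t) @^-1` N).
Proof.
move=> [B [mB B0 NB]]; exists ((fun x => x + t) @^-1` B); split.
- rewrite -[X in measurable X]setTI.
  have mS : measurable_fun setT (fun x : R => x + t) by exact: measurable_funD.
  exact: mS.
- by rewrite lebesgue_measure_preimage_shift.
- by move=> x; exact: NB.
Qed.

Lemma ae_shift (t : R) (P : R -> Prop) :
  {ae mu, forall x, P x} -> {ae mu, forall x, P (x + t)}.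
Proof. exact: negligible_preimage_shift. Qed.

Lemma ae_neq (t : R) : {ae mu, forall x, x != t}.
Proof.
exists [set t]; split; [exact: measurable_set1|exact: lebesgue_measure_set1|].
by move=> x /= /negP; rewrite negbK => /eqP.
Qed.

(** Links the Borel sets in [is_control] to measure theory on [R], where open intervals generate. *)
Lemma Borel_measurableE : Borel (T := R) = measurable.
Proof.
apply/seteqP; split => A.
  apply: smallest_sub; first exact: sigma_algebra_measurable.
  by move=> B; exact: open_measurable.
move=> mA; have : (RGenOpens.G (R := R)).-sigma.-measurable A.
  by rewrite -RGenOpens.measurableE.
apply: smallest_sub; first exact: smallest_sigma_algebra.
by move=> _ [x [y ->]]; apply: sub_sigma_algebra; exact: interval_open.
Qed.

End LebesgueTranslation.

(** * Absolutely continuous paths under changes of time *)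

Section AbsCont.
Variables (R : realType) (V : normedModType R).
Implicit Types (y h : R -> V).

Lemma abs_cont_cst (a b : R) (v : V) : abs_cont a b (fun=> v).
Proof.
move=> e e0; exists 1 => // n I _ _ _.
by rewrite big1// => i _; rewrite subrr normr0.
Qed.

Lemma abs_contD (a b : R) y h :
  abs_cont a b y -> abs_cont a b h -> abs_cont a b (fun s => y s + h s).
Proof.
move=> yac hac e e0; have e2 : 0 < e / 2 by rewrite divr_gt0.
have [d1 d10 H1] := yac _ e2; have [d2 d20 H2] := hac _ e2.
exists (Num.min d1 d2); first by rewrite lt_min d10.
move=> n I Iab Idisj; rewrite lt_min => /andP[I1 I2].
have := H1 n I Iab Idisj I1; have := H2 n I Iab Idisj I2.
move=> K2 K1; rewrite [e]splitr; apply: le_lt_trans (ltrD K1 K2).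
rewrite -big_split; apply: ler_sum => i _ /=.
by rewrite opprD addrACA; exact: ler_normD.
Qed.

(** A monotone change of time that does not stretch maps non-overlapping intervals to
    non-overlapping ones of no larger total length. It serves translations and truncations by [min]
    and [max]. *)
Lemma abs_cont_comp (a b a' b' : R) (phi : R -> R) y :
  (forall r s, r <= s -> phi r <= phi s) ->
  (forall r s, r <= s -> phi s - phi r <= s - r) ->
  (forall s, a <= s <= b -> a' <= phi s <= b') ->
  abs_cont a' b' y -> abs_cont a b (fun s => y (phi s)).
Proof.
move=> phi_mono phi_lip phi_ab yac e e0; have [d d0 H] := yac e e0.
exists d => // n I Iab Idisj Id.
apply: (H n (fun i => (phi (I i).1, phi (I i).2))) => /=.
- move=> i iltn; have [aI [I12 Ib]] := Iab i iltn.
  have /andP[? _] : a' <= phi (I i).1 <= b'.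
    by apply: phi_ab; rewrite aI (le_trans I12).
  have /andP[_ ?] : a' <= phi (I i).2 <= b'.
    by apply: phi_ab; rewrite Ib (le_trans aI).
  by split => //; split => //; exact: phi_mono.
- by move=> i j iltn jltn ij; have [?|?] := Idisj i j iltn jltn ij;
    [left|right]; exact: phi_mono.
- apply: le_lt_trans Id; apply: ler_sum => i _.
  by apply: phi_lip; have [_ []] := Iab i (ltn_ord i).
Qed.

(** Absolute continuity is used for a single interval, and the positive part does not increase
    distances. *)
Lemma abs_cont_continuous_pos y : (forall T : R, 0 < T -> abs_cont 0 T y) ->
  continuous (fun s : R => y (Num.max s 0)).
Proof.
move=> yac x; apply/cvgrPdist_lt => e e0.
pose T := Num.max x 0 + 1.
have x0 : 0 <= Num.max x 0 by rewrite le_max lexx orbT.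
have T0 : 0 < T by rewrite ltr_wpDl.
have [d d0 H] := yac T T0 e e0.
have H1 (p q : R) : 0 <= p -> p <= q -> q <= T -> q - p < d -> `|y q - y p| < e.
  move=> p0 pq qT qp; have := H 1%N (fun=> (p, q)).
  rewrite !big_ord1 /=; apply=> // i j; rewrite !ltnS !leqn0.
  by move=> /eqP-> /eqP->.
near=> z.
have xz1 : `|x - z| < 1 by near: z; apply: cvgr_dist_lt => //; exact: cvg_id.
have xzd : `|x - z| < d by near: z; apply: cvgr_dist_lt => //; exact: cvg_id.
have z0 : 0 <= Num.max z 0 by rewrite le_max lexx orbT.
have maxd : `|Num.max x 0 - Num.max z 0| <= `|x - z|.
  have : `|x - z| <= `|x - z| by [].
  rewrite ler_norml => /andP[? ?]; have := normr_ge0 (x - z).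
  move=> ?; rewrite (ler_norml (Num.max x 0 - _)); apply/andP.
  by case: (leP x 0) => ?; case: (leP z 0) => ?; split; lra.
have zT : Num.max z 0 <= T.
  move: (le_lt_trans maxd xz1); rewrite ltr_norml /T => /andP[? ?]; lra.
move: (le_lt_trans maxd xzd); rewrite ltr_norml => /andP[? ?].
have [xz|zx] := leP (Num.max x 0) (Num.max z 0).
  by rewrite distrC; apply: H1 => //; lra.
apply: H1 => //; [exact: ltW|rewrite /T; lra].
Unshelve. all: by end_near.
Qed.

(** The difference quotients coincide, so derivability and derivative transfer together. *)
Let growth_shift y (s t : R) :
  (fun h : R => h^-1 *: (((fun r => y (r + t)) \o shift s) (h *: 1) - y (s + t))) =
  (fun h : R => h^-1 *: ((y \o shift (s + t)) (h *: 1) - y (s + t))).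
Proof. by apply/funext => h /=; rewrite addrA. Qed.

Lemma derivable_shift_arg y (s t : R) :
  derivable y (s + t) 1 -> derivable (fun r => y (r + t)) s 1.
Proof. by rewrite /derivable growth_shift. Qed.

Lemma derive_shift_arg y (s t : R) :
  'D_1 (fun r => y (r + t)) s = 'D_1 y (s + t).
Proof. by rewrite /derive growth_shift. Qed.

End AbsCont.

(** * Measurability of a path paired with a control *)

Section JointMeasurability.
Variables (R : realType) (X U : topologicalType).

(* Covering by rational time windows: only the time line need be second
   countable, so [U] may be nonseparable. *)
Lemma measurable_preimage_Borel_prod (Y : R -> X) (V : R -> U) (W : set (X * U)) :
  continuous Y -> (forall B : set U, Borel B -> measurable (V @^-1` B)) ->
  Borel W -> measurable ((fun s => (Y s, V s)) @^-1` W).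
Proof.
move=> cY mV; move: W.
rewrite -/(subset _ [set W | measurable ((fun s => (Y s, V s)) @^-1` W)]).
(* Sets with measurable preimage form a sigma-algebra, so only open [W] remain. *)
apply: smallest_sub.
  split.
  - by rewrite /= preimage_set0.
  - by move=> A mA; rewrite /= setTD preimage_setC; exact: measurableC.
  - by move=> A mA; rewrite /= preimage_bigcup; exact: bigcupT_measurable.
move=> W oW.
(* Taking the interior makes this set open, hence Borel, although it is cut out by uncountably many
   times [r]. *)
pose Uw (p q : rat) := interior [set v | forall r, ratr p < r < ratr q -> W (Y r, v)].
rewrite /= (_ : _ @^-1` W = \bigcup_p \bigcup_q
    (`]ratr p, ratr q[%classic `&` V @^-1` (Uw p q))); last first.
  apply/seteqP; split => s /=.
    move=> Ws; have /= [[A B] /= [As Bs] ABW] : nbhs (Y s, V s) W.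
      exact: open_nbhs_nbhs.
    have /nbhs_ballP[e /= e0 eA] : nbhs s (Y @^-1` A) by exact: cY.
    have [p /itvP ps] := @rat_in_itvoo R (s - e) s ltac:(by rewrite ltrBlDr ltrDl).
    have [q /itvP qs] := @rat_in_itvoo R s (s + e) ltac:(by rewrite ltrDl).
    exists p => //; exists q => //; split; first by rewrite /= in_itv/= ps qs.
    rewrite /= /Uw /interior; apply: filterS Bs => v Bv r /andP[pr rq].
    apply: ABW; split => //=; apply: eA; rewrite /ball /= ltr_norml.
    have := ps; have := qs => *.
    have ? : s - e < ratr p by rewrite ps.
    have ? : ratr q < s + e by rewrite qs.
    apply/andP; split; lra.
  by move=> [p _ [q _ [spq /interior_subset Hs]]]; exact: Hs spq.
apply: bigcupT_measurable_rat => p; apply: bigcupT_measurable_rat => q.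
apply: measurableI; first exact: measurable_itv.
by apply: mV; apply: sub_sigma_algebra; exact: open_interior.
Qed.

End JointMeasurability.

(** * Shifting and concatenating controlled trajectories *)

Section Trajectories.
Variables (R : realType) (d : nat) (U : metricType R).
Variables (g : 'rV[R]_d * U -> R) (f : 'rV[R]_d * U -> 'rV[R]_d).
Implicit Types (u : R -> U) (y : R -> 'rV[R]_d) (x : 'rV[R]_d) (t : R).
Local Notation pos := (fun s : R => Num.max s 0).

Lemma is_control_shift u t : 0 <= t -> is_control u ->
  is_control (fun s => u (s + t)).
Proof.
move=> t0 cu B BB; rewrite Borel_measurableE.
rewrite (_ : _ `&` _ = [set s | 0 <= s] `&`
    (fun s => s + t) @^-1` ([set s | 0 <= s] `&` u @^-1` B)); last first.
  apply/seteqP; split => s /= [s0 us]; last by split => //; case: us.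
  by split => //; split => //; exact: addr_ge0.
apply: measurableI; first exact: measurable_ge0.
rewrite -[X in measurable X]setTI.
have mS : measurable_fun setT (fun s : R => s + t) by exact: measurable_funD.
by apply: mS => //; rewrite -Borel_measurableE; exact: cu.
Qed.

Lemma is_solution_shift u y x0 t : 0 <= t -> is_solution f u x0 y ->
  is_solution f (fun s => u (s + t)) (y t) (fun s => y (s + t)).
Proof.
move=> t0 [_ yac yae]; split; first by rewrite add0r.
- move=> T T0; apply: (@abs_cont_comp _ _ 0 T 0 (T + t) (fun s => s + t)).
  + by move=> r s; rewrite lerD2r.
  + by move=> r s _; rewrite opprD addrACA subrr addr0.
  + by move=> s /andP[s0 sT]; rewrite addr_ge0// lerD2r.
  + by apply: yac; rewrite ltr_pwDl.
- apply: (@filterS _ _ (ae_filter_ringOfSetsType _) _ _ _ (ae_shift t yae)) => s H s0.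
  have [yd yD] := H (ltr_pwDl s0 t0).
  by split; [exact: derivable_shift_arg|rewrite derive_shift_arg].
Qed.

Definition control_concat t u u' : R -> U :=
  fun s => if s < t then u s else u' (s - t).

(* Written as a sum so that absolute continuity needs no case analysis on
   intervals straddling [t]. *)
Definition path_concat t y y' : R -> 'rV[R]_d :=
  fun s => y (Num.min s t) + (y' (Num.max s t - t) + - y t).

Lemma path_concat_lt t y y' s : y' 0 = y t -> s <= t -> path_concat t y y' s = y s.
Proof.
move=> y't st; rewrite /path_concat (min_idPl st) (max_idPr st) subrr y't.
by rewrite subrr addr0.
Qed.

Lemma path_concat_ge t y y' s : t <= s -> path_concat t y y' s = y' (s - t).
Proof.
move=> ts; rewrite /path_concat (min_idPr ts) (max_idPl ts).
by rewrite addrCA subrr addr0.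
Qed.

Lemma is_control_concat t u u' : 0 <= t -> is_control u -> is_control u' ->
  is_control (control_concat t u u').
Proof.
move=> t0 cu cu' B BB; rewrite Borel_measurableE.
rewrite (_ : _ `&` _ =
    ([set s | 0 <= s] `&` u @^-1` B) `&` [set s | s < t] `|`
    [set s | t <= s] `&`
      (fun s => s - t) @^-1` ([set s | 0 <= s] `&` u' @^-1` B)); last first.
  apply/seteqP; split => s /=; rewrite /control_concat.
    by move=> [s0]; case: ltP => st Bs; [left|right; rewrite subr_ge0].
  move=> [[[s0 us] st]|[ts [_ us]]]; first by rewrite st.
  by rewrite (le_trans t0 ts) ltNge ts.
apply: measurableU; apply: measurableI.
- by rewrite -Borel_measurableE; exact: cu.
- by rewrite -set_itvNyo; exact: measurable_itv.
- by rewrite -set_itvcy; exact: measurable_itv.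
- rewrite -[X in measurable X]setTI.
  have mS : measurable_fun setT (fun s : R => s - t) by exact: measurable_funB.
  by apply: mS => //; rewrite -Borel_measurableE; exact: cu'.
Qed.

(** Near any time other than [t], the concatenation coincides with one of the two paths, so the
    equation is inherited there. *)
Lemma is_solution_concat t u u' y y' x0 : 0 <= t ->
  is_solution f u x0 y -> is_solution f u' (y t) y' ->
  is_solution f (control_concat t u u') x0 (path_concat t y y').
Proof.
move=> t0 [yx0 yac yae] [y't yac' yae']; split.
- by rewrite path_concat_lt.
- move=> T T0; have Tt : 0 < T + t by rewrite ltr_pwDl.
  (* The three summands are [y] stopped at [t], [y'] started at [t], and a constant. *)
  apply: abs_contD; last apply: abs_contD; last exact: abs_cont_cst.
  + apply: (@abs_cont_comp _ _ 0 T 0 (T + t) (fun s => Num.min s t)).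
    * by move=> r s rs; rewrite le_min !ge_min rs lexx orbT.
    * by move=> r s rs; case: (leP r t) => ?; case: (leP s t) => ?; lra.
    * move=> s /andP[s0 sT]; rewrite le_min s0 t0 ge_min.
      by rewrite (le_trans sT)// lerDl.
    * exact: yac.
  + apply: (@abs_cont_comp _ _ 0 T 0 (T + t) (fun s => Num.max s t - t)).
    * by move=> r s rs; rewrite lerD2r ge_max !le_max rs lexx orbT.
    * by move=> r s rs; case: (leP r t) => ?; case: (leP s t) => ?; lra.
    * by move=> s /andP[s0 sT]; case: (leP s t) => ?; apply/andP; split; lra.
    * exact: yac'.
- have yae't : {ae @lebesgue_measure R, forall s, 0 < s - t ->
      derivable y' (s - t) 1 /\ 'D_1 y' (s - t) = f (y' (s - t), u' (s - t))}.
    exact: (ae_shift (- t) yae').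
  (* The joining time [t], where a corner may occur, is discarded as a null set. *)
  apply: (@filterS3 _ _ (ae_filter_ringOfSetsType _) _ _ _ _ _ yae yae't (ae_neq t)) => s Hs Hst st s0.
  have [lt_st|] := ltP s t.
    have [yd yD] := Hs s0.
    have nearE : \forall r \near s, y r = path_concat t y y' r.
      near=> r; rewrite path_concat_lt//; apply/ltW; near: r.
      exact: lt_nbhsl.
    rewrite /control_concat lt_st -(nbhs_singleton nearE); split.
      exact: near_eq_derivable nearE yd.
    by rewrite -(near_eq_derive _ nearE).
  rewrite le_eqVlt eq_sym (negbTE st)/= => lt_ts.
  have [yd yD] : derivable y' (s - t) 1 /\ 'D_1 y' (s - t) = f (y' (s - t), u' (s - t)).
    by apply: Hst; rewrite subr_gt0.
  have nearE : \forall r \near s, y' (r - t) = path_concat t y y' r.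
    near=> r; rewrite path_concat_ge//; apply/ltW; near: r.
    exact: lt_nbhsr.
  rewrite /control_concat ltNge ltW//= -(nbhs_singleton nearE); split.
    exact: near_eq_derivable nearE (derivable_shift_arg yd).
  by rewrite -(near_eq_derive _ nearE) derive_shift_arg.
Unshelve. all: by end_near.
Qed.

(** Controls and trajectories are arbitrary at negative times; freezing them at time [0] gives
    streams measurable on the whole line. *)
Definition payoff_streams (x0 : 'rV[R]_d) : set (R -> R) :=
  [set h | exists u y, [/\ is_control u, is_solution f u x0 y &
                           h = fun s => g (y (pos s), u (pos s))]].

(** After composition with [pos] the trajectory is continuous and the control measurable, so the
    pair is jointly measurable. *)
Lemma payoff_streams_measurable x0 h : borel_fun g -> payoff_streams x0 h ->
  measurable_fun setT h.
Proof.
move=> bg [u [y [cu [_ yac _] ->]]] _ B mB; rewrite setTI.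
apply: (@measurable_preimage_Borel_prod _ _ _ (fun s => y (pos s)) (fun s => u (pos s))
          (g @^-1` B)).
- exact: abs_cont_continuous_pos.
- move=> C BC; rewrite (_ : _ @^-1` C = pos @^-1` ([set s | 0 <= s] `&` u @^-1` C)).
    rewrite -[X in measurable X]setTI; apply: measurable_pos => //.
    by rewrite -Borel_measurableE; exact: cu.
  by apply/seteqP; split => s /=; [move=> ?; split => //; exact: pos_ge0|case].
- by apply: bg; rewrite Borel_measurableE.
Qed.

(** The reachable state is [y t]: shifting the pair gives the first claim, concatenation at [t] the
    second. *)
Lemma payoff_streams_dynamic x0 h t : payoff_streams x0 h -> 0 <= t -> exists z,
  (exists2 h', payoff_streams z h' & forall s, 0 <= s -> h' s = h (s + t)) /\
  (forall h', payoff_streams z h' ->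
     exists2 h'', payoff_streams x0 h'' & forall s, 0 <= s -> h'' (s + t) = h' s).
Proof.
move=> [u [y [cu sy ->]]] t0; exists (y t); split.
  exists (fun s => g (y (pos s + t), u (pos s + t))).
    exists (fun s => u (s + t)), (fun s => y (s + t)); split => //.
      exact: is_control_shift.
    exact: is_solution_shift sy.
  by move=> s s0; rewrite (max_idPl s0) (max_idPl (addr_ge0 s0 t0)).
move=> _ [u' [y' [cu' sy' ->]]].
exists (fun s => g (path_concat t y y' (pos s), control_concat t u u' (pos s))).
  exists (control_concat t u u'), (path_concat t y y'); split => //.
    exact: is_control_concat.
  exact: is_solution_concat.
move=> s s0; rewrite (max_idPl s0) (max_idPl (addr_ge0 s0 t0)).
by rewrite path_concat_ge ?lerDr// /control_concat ltNge lerDr s0/= addrK.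
Qed.

(** For an evaluation only times [s >= 0] count, and there [pos] changes nothing. *)
Lemma Vshift_stream_val theta t x0 : borel_fun g ->
  (exists M : R, forall z, `|g z| <= M) -> evaluation theta -> 0 <= t ->
  Vshift g f theta t x0 = stream_val payoff_streams theta t x0.
Proof.
move=> bg [M gM] th0 t0.
have E u y : is_control u -> is_solution f u x0 y ->
    Rintegral theta [set s : R | 0 <= s] (fun s => g (y (s + t), u (s + t))) =
    stream_payoff theta t (fun s => g (y (pos s), u (pos s))).
  move=> cu sy.
  have hE (s : R) : g (y (pos s + t), u (pos s + t)) =
      (fun s => g (y (pos s), u (pos s))) (pos s + t).
    by rewrite /= (max_idPl (addr_ge0 (pos_ge0 s) t0)).
  rewrite (@Rintegral_pos _ _ _ M)//.
    by apply: eq_Rintegral => s _; exact: hE.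
  rewrite (funext hE).
  apply: (@measurable_shift_pos _ (fun s => g (y (pos s), u (pos s)))).
  by apply: (@payoff_streams_measurable x0) => //; exists u, y.
rewrite /Vshift /stream_val; congr inf; apply/seteqP; split => r.
  move=> [u [y [cu sy ->]]]; exists (fun s => g (y (pos s), u (pos s))).
    by exists u, y.
  by rewrite E.
by move=> [_ [u [y [cu sy ->]]] <-]; exists u, y; split => //; rewrite E.
Qed.

Lemma Vtheta_Vshift0 theta x0 : Vtheta g f theta x0 = Vshift g f theta 0 x0.
Proof.
by congr inf; apply/seteqP; split => r [u [y [cu sy ->]]]; exists u, y; split => //;
  apply: eq_Rintegral => s _; rewrite addr0.
Qed.

End Trajectories.

(** * Transfer from payoff streams to optimal control problems *)

Theorem mainTheorem1 (R : realType) (d : nat) (U : metricType R)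
  (g : 'rV[R]_d * U -> R) (f : 'rV[R]_d * U -> 'rV[R]_d)
  (L a : R) (thetas : nat -> probability R R) :
  borel_fun g ->
  (exists M : R, forall z, `|g z| <= M) ->
  borel_fun f ->
  0 <= L ->
  (forall (y ybar : 'rV[R]_d) (u : U), `|f (y, u) - f (ybar, u)| <= L * `|y - ybar|) ->
  0 < a ->
  (forall (y : 'rV[R]_d) (u : U), `|f (y, u)| <= a * (1 + `|y|)) ->
  (forall k, evaluation (thetas k)) ->
  LTC thetas ->
  [/\
   (* (i) *)
   (forall y0 : 'rV[R]_d,
      Vstar g f y0 =
      sup [set inf [set Vshift g f (thetas k) t y0 | t in [set t : R | 0 <= t]]
           | k in [set: nat]]),
   (* (ii) *)
   (forall W : 'rV[R]_d -> R,
      (forall e : R, 0 < e -> forall N : nat, exists2 k : nat, (N <= k)%N &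
          forall y, `|Vtheta g f (thetas k) y - W y| <= e) ->
      W = Vstar g f) &
   (* (iii) *)
   ((exists W : 'rV[R]_d -> R, forall e : R, 0 < e -> exists N : nat,
        forall k, (N <= k)%N -> forall y, `|Vtheta g f (thetas k) y - W y| <= e)
    <->
    (forall e : R, 0 < e -> exists (n : nat) (h : nat -> 'rV[R]_d -> R),
        forall k, exists2 i : nat, (i < n)%N &
          forall y, `|Vtheta g f (thetas k) y - h i y| <= e))].
Proof.
move=> bg gM _ _ _ _ _ thetas_ev thetas_LTC.
(* The bound is made strictly positive, since the error estimates divide by it. *)
have [M M0 gM0] : exists2 M : R, 0 < M & forall z, `|g z| <= M.
  have [M hM] := gM; exists (`|M| + 1); first by rewrite ltr_wpDl.
  by move=> z; apply: le_trans (hM z) _; rewrite ler_wpDr ?ler_norm.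
pose G := payoff_streams g f.
have Gm y h : G y h -> measurable_fun setT h by exact: payoff_streams_measurable.
have GM y h : G y h -> forall s, `|h s| <= M by move=> [u [x [_ _ ->]]].
have Gdyn y h t : G y h -> 0 <= t -> exists z,
    (exists2 h', G z h' & forall s, 0 <= s -> h' s = h (s + t)) /\
    (forall h', G z h' -> exists2 h'', G y h'' & forall s, 0 <= s -> h'' (s + t) = h' s).
  exact: payoff_streams_dynamic.
have lowE theta y : evaluation theta ->
    inf [set Vshift g f theta t y | t in [set t : R | 0 <= t]] = stream_low G theta y.
  move=> th0; congr inf; apply/seteqP; split => r [t t0 <-]; exists t => //;
    by rewrite Vshift_stream_val.
have valE k y : Vtheta g f (thetas k) y = stream_val G (thetas k) 0 y.
  by rewrite Vtheta_Vshift0 Vshift_stream_val.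
have supE : Vstar g f = stream_sup G.
  apply/funext => y; congr sup; apply/seteqP; split => r [theta [th0 ->]];
    by exists theta; rewrite lowE.
split.
- move=> y; rewrite supE (stream_sup_LTC M0 Gm GM thetas_ev thetas_LTC).
  by congr sup; apply/seteqP; split => r [k _ <-]; exists k => //; rewrite lowE.
- move=> W HW; rewrite supE.
  apply: (stream_val_accumulation M0 Gm GM thetas_ev thetas_LTC Gdyn) => e e0 N.
  have [k Nk Hk] := HW e e0 N; exists k => // y.
  by rewrite -valE.
- have H := stream_val_cvg_iff M0 Gm GM thetas_ev thetas_LTC Gdyn.
  split=> [[W HW] e e0|Htb].
    have [|n [c Hc]] := H.1 _ e e0.
      exists W => e' /HW[N HN]; exists N => k Nk y; rewrite -valE; exact: HN.
    exists n, c => k; have [i ilt Hi] := Hc k; exists i => // y.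
    by rewrite valE.
  have [|W HW] := H.2 _.
    move=> e /Htb[n [c Hc]]; exists n, c => k; have [i ilt Hi] := Hc k.
    by exists i => // y; rewrite -valE.
  exists W => e /HW[N HN]; exists N => k Nk y; rewrite valE; exact: HN.
Qed.
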